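(* Let $\mathfrak{g}$ be a complex Lie algebra and $\mathfrak{n}$ a Lie subalgebra of $\mathfrak{g}$. If the adjoint $\mathfrak{n}$-module $\mathfrak{g}/\mathfrak{n}$ belongs to $\mathfrak{W}^{\mathfrak{n}}_{\mathfrak{n}}$, then the functor $\mathrm{Ind}^{\mathfrak{g}}_{\mathfrak{n}}$ maps $\mathfrak{W}^{\mathfrak{n}}_{\mathfrak{n}}$ to $\mathfrak{W}^{\mathfrak{g}}_{\mathfrak{n}}$. In particular, $(\mathrm{Ind}^{\mathfrak{g}}_{\mathfrak{n}},\mathrm{Res}^{\mathfrak{g}}_{\mathfrak{n}})$ is an adjoint pair of functors between $\mathfrak{W}^{\mathfrak{n}}_{\mathfrak{n}}$ and $\mathfrak{W}^{\mathfrak{g}}_{\mathfrak{n}}$.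
   Context: Everything is over $\mathbb{C}$; Lie algebras may be infinite dimensional, and all vector spaces are assumed to have at most countable dimension. For a Lie algebra $\mathfrak{g}$ and a subalgebra $\mathfrak{n}$, $\mathfrak{W}^{\mathfrak{g}}_{\mathfrak{n}}$ is the full subcategory of the category of all $\mathfrak{g}$-modules consisting of those $M$ on which $\mathfrak{n}$ acts locally finitely, i.e. $\dim U(\mathfrak{n})v<\infty$ for all $v\in M$. Taking $\mathfrak{g}=\mathfrak{n}$, $\mathfrak{W}^{\mathfrak{n}}_{\mathfrak{n}}$ is the category of locally finite $\mathfrak{n}$-modules. $\mathrm{Res}^{\mathfrak{g}}_{\mathfrak{n}}$ is the restriction functor and $\mathrm{Ind}^{\mathfrak{g}}_{\mathfrak{n}}=U(\mathfrak{g})\otimes_{U(\mathfrak{n})}{}_{-}$ is the induction functor. The adjoint $\mathfrak{n}$-module structure on $\mathfrak{g}/\mathfrak{n}$ is the one induced by the Lie bracket. *)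

(* Defs.v *)
From HB Require Import structures.
From mathcomp Require Import all_boot all_order all_algebra.
From mathcomp Require Import generic_quotient ring_quotient.
From mathcomp Require Import finmap.
From mathcomp Require Import boolp.
From mathcomp Require Import monalg.

Set Implicit Arguments.
Unset Strict Implicit.
Unset Printing Implicit Defensive.

Import GRing.Theory.
Local Open Scope ring_scope.
Local Open Scope quotient_scope.

(* Locked definitions below keep unification from unfolding quotients and
   free modules. *)
Fact scale_key : unit. Proof. by []. Qed.
Fact gen_key : unit. Proof. by []. Qed.

Section Span.
Context {K : fieldType} {V : lmodType K}.

Inductive lspan (S : V -> Prop) : V -> Prop :=
| span_nil : lspan S 0
| span_cons a s v : S s -> lspan S v -> lspan S (a *: s + v).

Definition finite_dim (S : V -> Prop) : Prop :=
  exists e : seq V, (forall s, s \in e -> S s) /\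
    (forall v, S v -> lspan (fun s => s \in e) v).

Lemma span_base S s : S s -> lspan S s.
Proof.
by move=> Ss; rewrite -[s]addr0 -[s]scale1r; apply: span_cons => //; left.
Qed.

Lemma spanD S u v : lspan S u -> lspan S v -> lspan S (u + v).
Proof.
by elim=> [|a s w Ss _ IH] Sv; rewrite ?add0r// -addrA; apply/span_cons/IH.
Qed.

Lemma spanZ S a v : lspan S v -> lspan S (a *: v).
Proof.
elim=> [|b s w Ss _ IH]; first by rewrite scaler0; left.
by rewrite scalerDr scalerA; apply: span_cons.
Qed.

Definition spanb (S : V -> Prop) : {pred V} := fun v => `[< lspan S v >].

Lemma spanbP S v : reflect (lspan S v) (v \in spanb S).
Proof. exact: asboolP. Qed.

Lemma spanb_submod_closed S : submod_closed (spanb S).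
Proof.
split=> [|a u v /spanbP Su /spanbP Sv]; first by apply/spanbP; left.
by apply/spanbP/spanD => //; apply: spanZ.
Qed.

HB.instance Definition _ S :=
  GRing.isSubmodClosed.Build K V (spanb S) (spanb_submod_closed S).

(* [modq S] is the quotient vector space V / span(S). *)
Definition modq (S : V -> Prop) : Type := Quotient.quot (spanb S).
HB.instance Definition _ S := GRing.Zmodule.on (modq S).

Section Quotient.
Context (S : V -> Prop).

Definition modpi : V -> modq S := \pi_(Quotient.quot (spanb S)).

Lemma modpiP u v : modpi u = modpi v <-> lspan S (u - v).
Proof.
split=> [/eqP|uv]; first by rewrite /modpi -Quotient.idealrBE => /spanbP.
by apply/eqP; rewrite /modpi -Quotient.idealrBE; apply/spanbP.
Qed.

Lemma modpiK (x : modq S) : modpi (repr x) = x.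
Proof. exact: reprK. Qed.

Lemma repr_modpi v : lspan S (repr (modpi v) - v).
Proof. by apply/modpiP; rewrite modpiK. Qed.

Lemma modpiD u v : modpi (u + v) = modpi u + modpi v.
Proof. by rewrite /modpi piE. Qed.

Definition modq_scale : K -> modq S -> modq S :=
  locked_with scale_key (fun a x => modpi (a *: repr x)).

Lemma modpiZ a v : modpi (a *: v) = modq_scale a (modpi v).
Proof.
rewrite /modq_scale unlock; apply/modpiP; rewrite -scalerBr; apply: spanZ.
by rewrite -opprB -scaleN1r; apply/spanZ/repr_modpi.
Qed.

Lemma modq_scalerA a b x :
  modq_scale a (modq_scale b x) = modq_scale (a * b) x.
Proof. by rewrite -[x]modpiK -!modpiZ scalerA. Qed.
Lemma modq_scale1r : left_id 1 modq_scale.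
Proof. by move=> x; rewrite -[x]modpiK -!modpiZ scale1r. Qed.
Lemma modq_scalerDr : right_distributive modq_scale +%R.
Proof.
move=> a x y; rewrite -[x]modpiK -[y]modpiK -modpiD -!modpiZ.
by rewrite scalerDr modpiD.
Qed.
Lemma modq_scalerDl x : {morph modq_scale^~ x : a b / a + b}.
Proof.
by move=> a b; rewrite -[x]modpiK -!modpiZ -modpiD -scalerDl.
Qed.

HB.instance Definition _ := GRing.Zmodule_isLmodule.Build K (modq S)
  modq_scalerA modq_scale1r modq_scalerDr modq_scalerDl.

Lemma modpi_is_linear : linear modpi.
Proof. by move=> a u v; rewrite modpiD modpiZ. Qed.
HB.instance Definition _ :=
  GRing.isLinear.Build K V (modq S) _ modpi modpi_is_linear.

Lemma modq_lift (W : lmodType K) (f : {linear V -> W}) v :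
  (forall r, S r -> f r = 0) -> f (repr (modpi v)) = f v.
Proof.
move=> fS; apply/eqP; rewrite -subr_eq0 -linearB; apply/eqP.
elim: (repr_modpi v) => [|a r w Sr _ IH]; first exact: linear0.
by rewrite linearD linearZ /= fS // IH scaler0 addr0.
Qed.

End Quotient.
End Span.

Section FreeModule.
Context {K : fieldType} {X : choiceType} {V : lmodType K}.

(* The linear extension of [h] to the vector space with basis X. *)
Definition mext (h : X -> V) (p : {malg K[X]}) : V :=
  \sum_(k <- msupp p) p@_k *: h k.

Lemma mextEw h (d : {fset X}) p : (msupp p `<=` d)%fset ->
  mext h p = \sum_(k <- d) p@_k *: h k.
Proof.
move=> sd; apply: big_fset_incl => // k _ /mcoeff_outdom ->.
by rewrite scale0r.
Qed.

Lemma mext_is_linear h : linear (mext h).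
Proof.
move=> a p q; pose d := (msupp p `|` msupp q)%fset.
have dp : (msupp p `<=` d)%fset by apply: fsubsetUl.
have dq : (msupp q `<=` d)%fset by apply: fsubsetUr.
rewrite (mextEw h dp) (mextEw h dq) (@mextEw h d); last first.
  apply: fsubset_trans (msuppD_le _ _) _; rewrite fsubUset dq andbT.
  exact: fsubset_trans (msuppZ_le _ _) dp.
rewrite scaler_sumr -big_split; apply: eq_bigr => k _ /=.
by rewrite mcoeffD mcoeffZ scalerDl scalerA.
Qed.
HB.instance Definition _ h :=
  GRing.isLinear.Build K {malg K[X]} V _ (mext h) (mext_is_linear h).

Lemma mextU h k : mext h << k >> = h k.
Proof. by rewrite (mextEw _ msuppU_le) big_seq_fset1 mcoeffUU scale1r. Qed.

Lemma malgUZ a (k : X) : << a *g k >> = a *: << k >> :> {malg K[X]}.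
Proof. by apply/malgP => j; rewrite mcoeffZ !mcoeffU mulr_natr mulrb. Qed.

Lemma malg_linext (f1 f2 : {linear {malg K[X]} -> V}) :
  (forall k, f1 << k >> = f2 << k >>) -> f1 =1 f2.
Proof.
move=> ef p; rewrite (monalgE p) !linear_sum; apply: eq_bigr => k _.
by rewrite malgUZ !linearZ /= ef.
Qed.

End FreeModule.

Lemma malg_scalerAr (K : fieldType) (X : monomType) a (p q : {malg K[X]}) :
  a *: (p * q) = p * (a *: q).
Proof.
have C : a%:MP * p = p * a%:MP.
  rewrite (monalgE p) mulr_suml mulr_sumr; apply: eq_bigr => k _.
  by rewrite !malgM_def !fgmulUU mulrC mul1m mulm1.
by rewrite -!mul_malgC mulrA C -mulrA.
Qed.

HB.mixin Record Lmodule_isLieAlgebra (K : fieldType) g of GRing.Lmodule K g := {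
  lieb : g -> g -> g;
  liebPl : forall a x y z, lieb (a *: x + y) z = a *: lieb x z + lieb y z;
  liebPr : forall a x y z, lieb x (a *: y + z) = a *: lieb x y + lieb x z;
  liebxx : forall x, lieb x x = 0;
  lieb_jacobi : forall x y z,
    lieb x (lieb y z) + lieb y (lieb z x) + lieb z (lieb x y) = 0
}.

#[short(type="lieAlgType")]
HB.structure Definition LieAlgebra (K : fieldType) :=
  { g of GRing.Lmodule K g & Lmodule_isLieAlgebra K g }.

HB.mixin Record isLieClosed (K : fieldType) (g : lieAlgType K) (S : g -> bool) := {
  lieb_closed : forall x y, x \in (S : {pred g}) -> y \in (S : {pred g}) ->
    lieb x y \in (S : {pred g})
}.

#[short(type="lieSubalg")]
HB.structure Definition LieSubalg (K : fieldType) (g : lieAlgType K) :=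
  { S of @GRing.SubmodClosed K g S & isLieClosed K g S }.

HB.mixin Record Lmodule_isLieModule (K : fieldType) (h : lieAlgType K) M
    of GRing.Lmodule K M := {
  lact : h -> M -> M;
  lactPl : forall a x y m, lact (a *: x + y) m = a *: lact x m + lact y m;
  lactPr : forall a x m1 m2, lact x (a *: m1 + m2) = a *: lact x m1 + lact x m2;
  lact_lieb : forall x y m,
    lact (lieb x y) m = lact x (lact y m) - lact y (lact x m)
}.

#[short(type="lieModType")]
HB.structure Definition LieModule (K : fieldType) (h : lieAlgType K) :=
  { M of GRing.Lmodule K M & Lmodule_isLieModule K h M }.

HB.instance Definition _ K (h : lieAlgType K) (M : lieModType h) (x : h) :=
  GRing.isLinear.Build K M M _ (lact x) (fun a m1 m2 => lactPr a x m1 m2).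

HB.instance Definition _ K (g : lieAlgType K) (x : g) :=
  GRing.isLinear.Build K g g _ (lieb x) (fun a y z => liebPr a x y z).

Lemma liebC K (g : lieAlgType K) (x y : g) : lieb x y = - lieb y x.
Proof.
have lD a b c : lieb (a + b) c = lieb a c + lieb b c :> g.
  by rewrite -[a]scale1r liebPl !scale1r.
have rD a b c : lieb a (b + c) = lieb a b + lieb a c :> g.
  by rewrite -[b]scale1r liebPr !scale1r.
apply/eqP; rewrite -addr_eq0; apply/eqP.
by have := liebxx (x + y); rewrite lD !rD !liebxx add0r addr0.
Qed.

Section SubLie.
Context {K : fieldType} {g : lieAlgType K} (n : lieSubalg g).

Definition sublie : Type := {x : g | x \in n}.
HB.instance Definition _ := SubChoice.on sublie.
HB.instance Definition _ := [SubChoice_isSubLmodule of sublie by <:].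

Definition sub_lieb (x y : sublie) : sublie :=
  Sub (lieb (val x) (val y)) (lieb_closed _ _ (valP x) (valP y)).

Fact sub_liebPl a x y z :
  sub_lieb (a *: x + y) z = a *: sub_lieb x z + sub_lieb y z.
Proof. by apply: val_inj; rewrite /= liebPl. Qed.
Fact sub_liebPr a x y z :
  sub_lieb x (a *: y + z) = a *: sub_lieb x y + sub_lieb x z.
Proof. by apply: val_inj; rewrite /= liebPr. Qed.
Fact sub_liebxx x : sub_lieb x x = 0.
Proof. by apply: val_inj; rewrite /= liebxx. Qed.
Fact sub_lieb_jacobi x y z : sub_lieb x (sub_lieb y z) +
  sub_lieb y (sub_lieb z x) + sub_lieb z (sub_lieb x y) = 0.
Proof. by apply: val_inj; rewrite /= lieb_jacobi. Qed.

HB.instance Definition _ := Lmodule_isLieAlgebra.Build K sublie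
  sub_liebPl sub_liebPr sub_liebxx sub_lieb_jacobi.

End SubLie.

(* The quotient module g/n of the restricted adjoint module, with action
   x . (y + n) = [x, y] + n. *)
Section AdjointQuotient.
Context {K : fieldType} {g : lieAlgType K} (n : lieSubalg g).

Definition adquot : Type := modq (fun x : g => x \in n).
HB.instance Definition _ := GRing.Lmodule.on adquot.

Definition adquot_act (x : sublie n) (v : adquot) : adquot :=
  modpi _ (lieb (val x) (repr v)).

Lemma span_sub (x : g) : lspan (fun x : g => x \in n) x -> x \in n.
Proof.
elim=> [|a s v sn _ vn]; first exact: rpred0.
by apply: rpredD => //; apply: rpredZ.
Qed.

Lemma adquot_actE x y : adquot_act x (modpi _ y) = modpi _ (lieb (val x) y).
Proof.
apply/modpiP; rewrite -linearB.
by apply/span_base/lieb_closed; [exact: valP|apply/span_sub/repr_modpi].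
Qed.

Fact adquot_actPl a x y v :
  adquot_act (a *: x + y) v = a *: adquot_act x v + adquot_act y v.
Proof. by rewrite -[v]modpiK !adquot_actE -linearP /= liebPl. Qed.
Fact adquot_actPr a x v w :
  adquot_act x (a *: v + w) = a *: adquot_act x v + adquot_act x w.
Proof.
by rewrite -[v]modpiK -[w]modpiK -linearP !adquot_actE liebPr linearP.
Qed.
Fact adquot_act_lieb x y v : adquot_act (lieb x y) v =
  adquot_act x (adquot_act y v) - adquot_act y (adquot_act x v).
Proof.
rewrite -[v]modpiK !adquot_actE -linearB /=; congr (modpi _ _).
have := lieb_jacobi (val x) (val y) (repr v).
rewrite [lieb _ (lieb (val x) (val y))]liebC => /eqP.
rewrite subr_eq0 => /eqP <-; congr (_ + _).
by rewrite [lieb (repr v) _]liebC linearN.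
Qed.

HB.instance Definition _ := Lmodule_isLieModule.Build K (sublie n) adquot
  adquot_actPl adquot_actPr adquot_act_lieb.

End AdjointQuotient.

Lemma scalar_morph_rel (K : fieldType) (A : lalgType K) (e : A -> K) :
    scalar e -> {morph e : p q / p * q} ->
  [/\ forall a p q r, e p = 0 -> e q = 0 -> e r = 0 ->
       e (r - (a *: p + q)) = 0,
     forall p q r, e p = 0 -> e q = 0 -> e r = 0 -> e (r - (p * q - q * p)) = 0
   & forall b r c, e r = 0 -> e (b * r * c) = 0].
Proof.
move=> eL eM; have e0 : e 0 = 0.
  by have := eL (-1) 0 0; rewrite addr0 scaler0 mulN1r addNr.
have eZ a p : e (a *: p) = a * e p by rewrite -[a *: p]addr0 eL e0 addr0.
have eD p q : e (p + q) = e p + e q by rewrite -[p]scale1r eL mul1r scale1r.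
have eB p q : e (p - q) = e p - e q by rewrite -[- q]scaleN1r eD eZ mulN1r.
split=> [a p q r ep eq er|p q r ep eq er|b r c er].
- by rewrite eB eD eZ ep eq er mulr0 addr0 subr0.
- by rewrite eB eB !eM ep eq er mulr0 !subr0.
- by rewrite !eM er mulr0 mul0r.
Qed.

Section Uenv.
Context {K : fieldType} (g : lieAlgType K).

Local Notation freealg := {malg K[{fmonom g}]}.

Definition fgen : g -> freealg := locked_with gen_key (fun x => << fmu x >>).

Lemma fgenE x : fgen x = << fmu x >>.
Proof. by rewrite /fgen unlock. Qed.

Inductive Urel : freealg -> Prop :=
| Urel_lin a x y : Urel (fgen (a *: x + y) - (a *: fgen x + fgen y))
| Urel_lieb x y :
    Urel (fgen (lieb x y) - (fgen x * fgen y - fgen y * fgen x)).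

Inductive Uideal : freealg -> Prop :=
| Uideal_rel p r q : Urel r -> Uideal (p * r * q).

Lemma Uideal_gen r : Urel r -> Uideal r.
Proof. by move=> /(Uideal_rel 1 1); rewrite mul1r mulr1. Qed.

(* U(g): the free associative algebra on the set underlying g, modulo the
   two-sided ideal generated by the linear relations of g and the relations
   [x, y] = x y - y x. *)
Definition Uenv : Type := modq Uideal.
HB.instance Definition _ := GRing.Lmodule.on Uenv.

Lemma Uideal_mull p q : lspan Uideal q -> lspan Uideal (p * q).
Proof.
elim=> [|a s w [b r c rr] _ IH]; first by rewrite mulr0; left.
by rewrite mulrDr -malg_scalerAr !mulrA; apply: span_cons.
Qed.
Lemma Uideal_mulr p q : lspan Uideal q -> lspan Uideal (q * p).
Proof.
elim=> [|a s w [b r c rr] _ IH]; first by rewrite mul0r; left.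
rewrite mulrDl -(scalerAl a (b * r * c) p) -[b * r * c * p]mulrA.
by apply: span_cons.
Qed.

Definition Upi : freealg -> Uenv := modpi Uideal.
HB.instance Definition _ := GRing.Linear.on Upi.

Lemma UpiD p q : Upi (p + q) = Upi p + Upi q. Proof. exact: linearD. Qed.
Lemma UpiZ a p : Upi (a *: p) = a *: Upi p. Proof. exact: linearZ. Qed.

Fact Umul_key : unit. Proof. by []. Qed.

Definition Umul : Uenv -> Uenv -> Uenv :=
  locked_with Umul_key (fun u v => Upi (repr u * repr v)).

Lemma Upi_mul p q : Upi (p * q) = Umul (Upi p) (Upi q).
Proof.
rewrite /Umul unlock; apply/esym/modpiP; set p' := repr _; set q' := repr _.
have -> : p' * q' - p * q = (p' - p) * q' + p * (q' - q).
  by rewrite mulrBl mulrBr addrA subrK.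
by apply: spanD; [apply: Uideal_mulr|apply: Uideal_mull]; apply: repr_modpi.
Qed.

Lemma UpiK (u : Uenv) : Upi (repr u) = u. Proof. exact: modpiK. Qed.

Fact UmulA : associative Umul.
Proof.
move=> u v w; rewrite -[u]UpiK -[v]UpiK -[w]UpiK -!Upi_mul mulrA //.
Qed.
Fact Umul1u : left_id (Upi 1) Umul.
Proof. by move=> u; rewrite -[u]UpiK -!Upi_mul mul1r. Qed.
Fact Umulu1 : right_id (Upi 1) Umul.
Proof. by move=> u; rewrite -[u]UpiK -!Upi_mul mulr1. Qed.
Fact UmulDl : left_distributive Umul +%R.
Proof.
move=> u v w; rewrite -[u]UpiK -[v]UpiK -[w]UpiK.
by rewrite -linearD -!Upi_mul mulrDl linearD.
Qed.
Fact UmulDr : right_distributive Umul +%R.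
Proof.
move=> u v w; rewrite -[u]UpiK -[v]UpiK -[w]UpiK.
by rewrite -linearD -!Upi_mul mulrDr linearD.
Qed.

Lemma Uideal_mcoeff1 (p : freealg) : lspan Uideal p -> p@_(fmone g) = 0.
Proof.
have [eM _] := @mcoeff1g_is_multiplicative {fmonom g} K.
have eX x : (fgen x)@_(fmone g) = 0.
  by rewrite fgenE mcoeffU; case: eqP => //; rewrite fmuE fmoneE.
have eL : scalar (fun p : freealg => p@_(fmone g)).
  by move=> a p' q; rewrite mcoeffD mcoeffZ.
have [eab ecomm eid] := scalar_morph_rel eL eM.
elim=> [|a s w [b r c rr] _ IH]; first exact: mcoeff0.
rewrite eL IH addr0 eid ?mulr0 //.
by case: rr => [d x y|x y]; [apply: eab|apply: ecomm]; apply: eX.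
Qed.

Fact Uenv_neq0 : Upi 1 != 0.
Proof.
apply/eqP; rewrite -(linear0 Upi) => /modpiP /Uideal_mcoeff1 /eqP.
by rewrite subr0 mcoeff1 eqxx oner_eq0.
Qed.

HB.instance Definition _ := GRing.Zmodule_isNzRing.Build Uenv
  UmulA Umul1u Umulu1 UmulDl UmulDr Uenv_neq0.

Lemma UpiM p q : Upi (p * q) = Upi p * Upi q. Proof. exact: Upi_mul. Qed.

Fact Uenv_scalerAl a (u v : Uenv) : a *: (u * v) = a *: u * v.
Proof.
by rewrite -[u]UpiK -[v]UpiK -UpiM -UpiZ scalerAl UpiM UpiZ.
Qed.
HB.instance Definition _ := GRing.Lmodule_isLalgebra.Build K Uenv Uenv_scalerAl.
Fact Uenv_scalerAr a (u v : Uenv) : a *: (u * v) = u * (a *: v).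
Proof.
by rewrite -[u]UpiK -[v]UpiK -UpiM -UpiZ malg_scalerAr UpiM UpiZ.
Qed.
HB.instance Definition _ :=
  GRing.Lalgebra_isAlgebra.Build K Uenv Uenv_scalerAr.

Definition Uin (x : g) : Uenv := Upi (fgen x).

Lemma Uin_is_linear : linear Uin.
Proof.
move=> a x y; rewrite /Uin -linearP; apply/modpiP/span_base/Uideal_gen.
exact: Urel_lin.
Qed.
HB.instance Definition _ := GRing.isLinear.Build K g Uenv _ Uin Uin_is_linear.

Lemma Uin_lieb x y : Uin (lieb x y) = Uin x * Uin y - Uin y * Uin x.
Proof.
rewrite /Uin -!UpiM -linearB; apply/modpiP/span_base/Uideal_gen.
exact: Urel_lieb.
Qed.

End Uenv.

Lemma linear_rel1 (K : fieldType) (V W : lmodType K) (f : V -> W) : linear f ->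
  forall a p q r, f (r - (a *: p + q)) = f r - (a *: f p + f q).
Proof.
move=> fL a p q r; pose F := GRing.isLinear.Build K V W _ f fL.
pose f' : {linear V -> W} := HB.pack f F.
by rewrite -[f]/(f' : V -> W) linearB linearP.
Qed.

Lemma linear_rel2 (K : fieldType) (V W : lmodType K) (f : V -> W) : linear f ->
  forall p q r, f (r - (p - q)) = f r - (f p - f q).
Proof.
move=> fL p q r; pose F := GRing.isLinear.Build K V W _ f fL.
pose f' : {linear V -> W} := HB.pack f F.
by rewrite -[f]/(f' : V -> W) !linearB.
Qed.

Lemma malg_ind (K : fieldType) (X : choiceType) (P : {malg K[X]} -> Prop) :
  P 0 -> (forall a k p, P p -> P (a *: << k >> + p)) -> forall p, P p.
Proof.
move=> P0 Pcons p; rewrite (monalgE p); elim: (enum_fset (msupp p)) => [|k s IH].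
  by rewrite big_nil.
by rewrite big_cons malgUZ; apply: Pcons.
Qed.

(* The homomorphism U(h) -> A extending a linear map f : h -> A with
   f [x, y] = f x * f y - f y * f x. *)
Definition Ulift (K : fieldType) (h : lieAlgType K) (A : algType K)
    (f : h -> A) (u : Uenv h) : A :=
  mext (fun k : {fmonom h} => \prod_(x <- (k : seq h)) f x) (repr u).

Section Uaction.
Context {K : fieldType} {h : lieAlgType K} {M : lieModType h}.

Definition word_act (m : M) (k : {fmonom h}) : M := foldr lact m k.

Definition uact (u : Uenv h) (m : M) : M := mext (word_act m) (repr u).

Lemma word_actP a (m1 m2 : M) k :
  word_act (a *: m1 + m2) k = a *: word_act m1 k + word_act m2 k.
Proof. by rewrite /word_act; elim: (k : seq h) => //= x s ->; rewrite lactPr. Qed.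

Lemma word_act0 k : word_act (0 : M) k = 0.
Proof.
have := word_actP (-1) (0 : M) 0 k.
by rewrite scaler0 addr0 scaleN1r addNr.
Qed.

Lemma free_actM (p q : {malg K[{fmonom h}]}) (m : M) :
  mext (word_act m) (p * q) = mext (word_act (mext (word_act m) q)) p.
Proof.
elim/malg_ind: p => [|a k p IH]; first by rewrite mul0r !linear0.
rewrite [RHS]mext_is_linear -IH mulrDl -(scalerAl a << k >> q) mext_is_linear; congr (_ *: _ + _).
rewrite mextU; elim/malg_ind: q {IH} => [|b l q IH].
  rewrite mulr0 !linear0; exact/esym/word_act0.
rewrite [in RHS]mext_is_linear word_actP -IH mulrDr -malg_scalerAr mext_is_linear; congr (_ *: _ + _).
by rewrite malgM_def fgmulUU mulr1 !mextU /word_act fmM foldr_cat.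
Qed.

Lemma free_act_gen x m : mext (word_act m) (fgen x) = lact x m.
Proof. by rewrite fgenE mextU /word_act fmuE. Qed.

Lemma uact_pi p m : uact (Upi p) m = mext (word_act m) p.
Proof.
apply: (modq_lift (f := mext (word_act m))) => _ [b r c rr].
rewrite /= !free_actM; set m' := mext _ c.
have -> : mext (word_act m') r = 0.
  have L := mext_is_linear (word_act m').
  case: rr => [a x y|x y].
    by rewrite (linear_rel1 L) !free_act_gen lactPl subrr.
  rewrite (linear_rel2 L) free_act_gen lact_lieb.
  apply/eqP; rewrite subr_eq0; apply/eqP.
  by congr (_ - _); rewrite free_actM free_act_gen free_act_gen.
elim/malg_ind: b => [|a k p' IH]; first exact: linear0.
by rewrite mext_is_linear IH mextU word_act0 scaler0 addr0.
Qed.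

Lemma uact_Uin x m : uact (Uin x) m = lact x m.
Proof. by rewrite uact_pi free_act_gen. Qed.

Lemma uact1 m : uact 1 m = m.
Proof. by rewrite uact_pi mextU /word_act fm1. Qed.

Lemma uactM u v m : uact (u * v) m = uact u (uact v m).
Proof. by rewrite -[u]UpiK -[v]UpiK -UpiM !uact_pi free_actM. Qed.

Lemma uactPl a u v m : uact (a *: u + v) m = a *: uact u m + uact v m.
Proof.
by rewrite -[u]UpiK -[v]UpiK -UpiZ -UpiD !uact_pi mext_is_linear.
Qed.

Lemma uactPr a u m1 m2 : uact u (a *: m1 + m2) = a *: uact u m1 + uact u m2.
Proof.
rewrite /uact; elim/malg_ind: (repr u) => [|b k p IH].
  by rewrite !linear0 addr0.
rewrite !mext_is_linear IH !mextU word_actP !scalerDr !scalerA [b * a]mulrC.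
by rewrite addrACA.
Qed.

End Uaction.

Section UliftTheory.
Context {K : fieldType} {h : lieAlgType K} {A : algType K} {f : h -> A}.
Context (fL : linear f).
Context (f_lieb : forall x y, f (lieb x y) = f x * f y - f y * f x).

Definition word_prod (k : {fmonom h}) : A := \prod_(x <- (k : seq h)) f x.

Lemma free_liftM p q : mext word_prod (p * q) = mext word_prod p * mext word_prod q.
Proof.
elim/malg_ind: p => [|a k p IH]; first by rewrite mul0r !linear0 mul0r.
rewrite [in RHS]mext_is_linear [in RHS]mulrDl -IH.
rewrite mulrDl -(scalerAl a << k >> q) mext_is_linear; congr (_ + _).
rewrite -scalerAl; congr (_ *: _); elim/malg_ind: q {IH} => [|b l q IH].
  by rewrite mulr0 !linear0 mulr0.
rewrite [in RHS]mext_is_linear [in RHS]mulrDr -IH -scalerAr.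
rewrite mulrDr -malg_scalerAr mext_is_linear; congr (_ *: _ + _).
by rewrite malgM_def fgmulUU mulr1 !mextU /word_prod fmM big_cat.
Qed.

Lemma free_lift_gen x : mext word_prod (fgen x) = f x.
Proof. by rewrite fgenE mextU /word_prod fmuE big_seq1. Qed.

Lemma Ulift_pi p : Ulift f (Upi p) = mext word_prod p.
Proof.
apply: (modq_lift (f := mext word_prod)) => _ [b r c rr].
rewrite /= !free_liftM; have L := mext_is_linear word_prod.
suff -> : mext word_prod r = 0 by rewrite mulr0 mul0r.
case: rr => [a x y|x y].
  by rewrite (linear_rel1 L) !free_lift_gen fL subrr.
rewrite (linear_rel2 L) free_lift_gen f_lieb.
apply/eqP; rewrite subr_eq0; apply/eqP.
by congr (_ - _); rewrite free_liftM free_lift_gen free_lift_gen.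
Qed.

Lemma Ulift_Uin x : Ulift f (Uin x) = f x.
Proof. by rewrite Ulift_pi free_lift_gen. Qed.

Lemma Ulift1 : Ulift f 1 = 1.
Proof. by rewrite Ulift_pi mextU /word_prod fm1 big_nil. Qed.

Lemma UliftM u v : Ulift f (u * v) = Ulift f u * Ulift f v.
Proof. by rewrite -[u]UpiK -[v]UpiK -UpiM !Ulift_pi free_liftM. Qed.

Lemma UliftP : linear (Ulift f).
Proof.
move=> a u v; rewrite -[u]UpiK -[v]UpiK -UpiZ -UpiD !Ulift_pi.
exact: mext_is_linear.
Qed.

End UliftTheory.

Section LieHom.
Context {K : fieldType} {h : lieAlgType K}.

Record lieHom (M N : lieModType h) := LieHom {
  lieHom_fun :> {linear M -> N};
  lieHomE : forall x m, lieHom_fun (lact x m) = lact x (lieHom_fun m)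
}.

Lemma lieHom_eq (M N : lieModType h) (f1 f2 : lieHom M N) :
  f1 =1 f2 -> f1 = f2.
Proof.
case: f1 f2 => [[f1 c1] e1] [[f2 c2] e2] /= /funext ef.
rewrite /= {}ef in c1 e1 *.
have ec : c1 = c2.
  case: c1 c2 {e1 e2} => [[z1] [s1]] [[z2] [s2]].
  by rewrite (Prop_irrelevance z1 z2) (Prop_irrelevance s1 s2).
by rewrite {}ec in e1 *; congr LieHom; apply: Prop_irrelevance.
Qed.

Definition lieHom_id (M : lieModType h) : lieHom M M :=
  @LieHom M M idfun (fun _ _ => erefl).

Fact lieHom_comp_subproof (M N P : lieModType h) (f : lieHom N P)
    (e : lieHom M N) x m :
  (f \o e) (lact x m) = lact x ((f \o e) m).
Proof. by rewrite /= !lieHomE. Qed.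

Definition lieHom_comp (M N P : lieModType h) (f : lieHom N P)
    (e : lieHom M N) : lieHom M P :=
  @LieHom M P (f \o e) (lieHom_comp_subproof f e).

End LieHom.

Record category := Category {
  obj :> Type;
  hom : obj -> obj -> Type;
  cat_id : forall X, hom X X;
  cat_comp : forall X Y Z, hom Y Z -> hom X Y -> hom X Z;
  cat_comp1f : forall X Y (f : hom X Y), cat_comp (cat_id Y) f = f;
  cat_compf1 : forall X Y (f : hom X Y), cat_comp f (cat_id X) = f;
  cat_compA : forall X Y Z T (f : hom Z T) (e : hom Y Z) (d : hom X Y),
    cat_comp f (cat_comp e d) = cat_comp (cat_comp f e) d
}.
Arguments hom {c} X Y.
Arguments cat_id {c} X.
Arguments cat_comp {c X Y Z} f e.

Record functor (C D : category) := Functor {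
  fobj :> C -> D;
  fmor : forall X Y : C, hom X Y -> hom (fobj X) (fobj Y);
  fmor_id : forall X : C, fmor (cat_id X) = cat_id (fobj X);
  fmor_comp : forall (X Y Z : C) (f : hom Y Z) (e : hom X Y),
    fmor (cat_comp f e) = cat_comp (fmor f) (fmor e)
}.
Arguments fmor {C D} F {X Y} f : rename.

(* F is left adjoint to G: a bijection Hom(F X, Y) ~ Hom(X, G Y), natural in
   X and Y. *)
Definition adjoint_pair (C D : category) (F : functor C D) (G : functor D C) :
    Prop :=
  exists phi : forall (X : C) (Y : D), hom (F X) Y -> hom X (G Y),
    (forall X Y, bijective (phi X Y)) /\
    (forall (X X' : C) (Y Y' : D) (a : hom X' X) (b : hom Y Y')
       (f : hom (F X) Y),
      phi X' Y' (cat_comp b (cat_comp f (fmor F a))) =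
      cat_comp (fmor G b) (cat_comp (phi X Y f) a)).

Section FullSubcategory.
Context (C : category) (P : C -> Prop).

Definition full_subcat : category :=
  @Category {X : C | P X} (fun X Y => hom (sval X) (sval Y))
    (fun X => cat_id (sval X)) (fun X Y Z f e => cat_comp f e)
    (fun X Y f => cat_comp1f f) (fun X Y f => cat_compf1 f)
    (fun X Y Z T f e d => cat_compA f e d).

End FullSubcategory.

(* The functor between full subcategories induced by a functor F that sends
   the objects satisfying P to objects satisfying Q. *)
Definition full_functor (C D : category) (F : functor C D) (P : C -> Prop)
    (Q : D -> Prop) (FPQ : forall X, P X -> Q (F X)) :
    functor (full_subcat P) (full_subcat Q) :=
  @Functor (full_subcat P) (full_subcat Q)
    (fun X => exist Q (F (sval X)) (FPQ (sval X) (svalP X)))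
    (fun X Y f => fmor F f) (fun X => fmor_id F (sval X))
    (fun X Y Z f e => fmor_comp F f e).

Section ModuleCategory.
Context {K : fieldType} (h : lieAlgType K).

Fact lieHom_comp1f (M N : lieModType h) (f : lieHom M N) :
  lieHom_comp (lieHom_id N) f = f.
Proof. exact: lieHom_eq. Qed.
Fact lieHom_compf1 (M N : lieModType h) (f : lieHom M N) :
  lieHom_comp f (lieHom_id M) = f.
Proof. exact: lieHom_eq. Qed.
Fact lieHom_compA (M N P Q : lieModType h) (f : lieHom P Q) (e : lieHom N P)
    (d : lieHom M N) :
  lieHom_comp f (lieHom_comp e d) = lieHom_comp (lieHom_comp f e) d.
Proof. exact: lieHom_eq. Qed.

Definition lieModCat : category :=
  @Category (lieModType h) (@lieHom K h) (@lieHom_id K h)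
    (@lieHom_comp K h) lieHom_comp1f lieHom_compf1 lieHom_compA.

End ModuleCategory.

Section Restriction.
Context {K : fieldType} {g : lieAlgType K} (n : lieSubalg g).

Definition res (M : lieModType g) : Type := M.

Section ResModule.
Context (M : lieModType g).
HB.instance Definition _ := GRing.Lmodule.on (res M).

Definition res_act (x : sublie n) (m : res M) : res M := lact (val x) (m : M).

Fact res_actPl a x y m :
  res_act (a *: x + y) m = a *: res_act x m + res_act y m.
Proof. exact: lactPl. Qed.
Fact res_actPr a x m1 m2 :
  res_act x (a *: m1 + m2) = a *: res_act x m1 + res_act x m2.
Proof. exact: lactPr. Qed.
Fact res_act_lieb x y m :
  res_act (lieb x y) m = res_act x (res_act y m) - res_act y (res_act x m).
Proof. exact: lact_lieb. Qed.
HB.instance Definition _ := Lmodule_isLieModule.Build K (sublie n) (res M)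
  res_actPl res_actPr res_act_lieb.
End ResModule.

Definition res_mod (M : lieModType g) : lieModType (sublie n) := res M.

Definition res_map (M N : lieModType g) (f : lieHom M N) :
    lieHom (res_mod M) (res_mod N) :=
  @LieHom K (sublie n) (res_mod M) (res_mod N) (lieHom_fun f)
    (fun x m => lieHomE f (val x) m).

Fact res_map_id (M : lieModType g) : res_map (lieHom_id M) = lieHom_id _.
Proof. exact: lieHom_eq. Qed.
Fact res_map_comp (M N P : lieModType g) (f : lieHom N P) (e : lieHom M N) :
  res_map (lieHom_comp f e) = lieHom_comp (res_map f) (res_map e).
Proof. exact: lieHom_eq. Qed.

Definition Res : functor (lieModCat g) (lieModCat (sublie n)) :=
  @Functor (lieModCat g) (lieModCat (sublie n)) res_mod res_map
    res_map_id res_map_comp.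

End Restriction.

Section Induction.
Context {K : fieldType} {g : lieAlgType K} (n : lieSubalg g).

Definition Usub : Uenv (sublie n) -> Uenv g :=
  Ulift (fun x : sublie n => Uin (val x : g)).

Section IndModule.
Context (M : lieModType (sublie n)).

Definition tgen : Uenv g -> M -> {malg K[(Uenv g * M)%type]} :=
  locked_with gen_key (fun u m => << (u, m) >>).

Lemma tgenE u m : tgen u m = << (u, m) >>.
Proof. by rewrite /tgen unlock. Qed.

(* The relations defining U(g) (x)_{U(n)} M as a quotient of the vector space
   with basis U(g) x M. *)
Inductive tensrel : {malg K[(Uenv g * M)%type]} -> Prop :=
| tensrel_l a u v m :
    tensrel (tgen (a *: u + v) m - (a *: tgen u m + tgen v m))
| tensrel_r a u m1 m2 :
    tensrel (tgen u (a *: m1 + m2) - (a *: tgen u m1 + tgen u m2))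
| tensrel_bal u (w : Uenv (sublie n)) m :
    tensrel (tgen (u * Usub w) m - tgen u (uact w m)).

Definition ind : Type := modq tensrel.
HB.instance Definition _ := GRing.Lmodule.on ind.

Definition tens (u : Uenv g) (m : M) : ind := modpi tensrel (tgen u m).

Lemma tensPl a u v m : tens (a *: u + v) m = a *: tens u m + tens v m.
Proof. by rewrite /tens -linearP; apply/modpiP/span_base/tensrel_l. Qed.
Lemma tensPr a u m1 m2 : tens u (a *: m1 + m2) = a *: tens u m1 + tens u m2.
Proof. by rewrite /tens -linearP; apply/modpiP/span_base/tensrel_r. Qed.
Lemma tens_bal u w m : tens (u * Usub w) m = tens u (uact w m).
Proof. exact/modpiP/span_base/tensrel_bal. Qed.

(* Left multiplication: u . (v (x) m) = (u v) (x) m. *)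
Definition ind_uact (u : Uenv g) (t : ind) : ind :=
  mext (fun vm : (Uenv g * M)%type => tens (u * vm.1) vm.2) (repr t).

Definition ind_act (x : g) (t : ind) : ind := ind_uact (Uin x) t.

End IndModule.

Section TensLift.
Context {M : lieModType (sublie n)} {V : lmodType K}.
Context {f : Uenv g * M -> V}.
Context (fPl : forall a u v m, f (a *: u + v, m) = a *: f (u, m) + f (v, m)).
Context (fPr : forall a u m1 m2,
  f (u, a *: m1 + m2) = a *: f (u, m1) + f (u, m2)).
Context (f_bal : forall u w m, f (u * Usub w, m) = f (u, uact w m)).

Lemma tens_lift_pi p : mext f (repr (modpi (@tensrel M) p)) = mext f p.
Proof.
apply: (modq_lift (f := mext f)) => r rr /=.
have L := mext_is_linear f.
have G u m : mext f (tgen u m) = f (u, m) by rewrite tgenE mextU.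
case: rr => [a u v m|a u m1 m2|u w m].
- rewrite (linear_rel1 L); apply/eqP; rewrite subr_eq0; apply/eqP.
  by rewrite [LHS]G fPl; congr (_ *: _ + _); apply/esym/G.
- rewrite (linear_rel1 L); apply/eqP; rewrite subr_eq0; apply/eqP.
  by rewrite [LHS]G fPr; congr (_ *: _ + _); apply/esym/G.
- rewrite (linearB (mext f)); apply/eqP; rewrite subr_eq0; apply/eqP.
  by rewrite [LHS]G f_bal; apply/esym/G.
Qed.

Lemma tens_lift_linear : linear (fun t : ind M => mext f (repr t)).
Proof.
move=> a s t; rewrite -[s]modpiK -[t]modpiK -linearP !tens_lift_pi.
exact: mext_is_linear.
Qed.

Lemma tens_lift u m : mext f (repr (tens u m)) = f (u, m).
Proof. by rewrite tens_lift_pi tgenE mextU. Qed.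

End TensLift.

Lemma tens_ind (M : lieModType (sublie n)) (P : ind M -> Prop) :
  P 0 -> (forall a u m t, P t -> P (a *: tens u m + t)) -> forall t, P t.
Proof.
move=> P0 Pc t; rewrite -[t]modpiK; elim/malg_ind: (repr t) => [|a [u m] p IH].
  by rewrite linear0.
by rewrite linearP -tgenE; apply: Pc.
Qed.

Section IndAction.
Context (M : lieModType (sublie n)).

Lemma ind_uactPr a u (s t : ind M) :
  ind_uact u (a *: s + t) = a *: ind_uact u s + ind_uact u t.
Proof.
apply: tens_lift_linear => /= [b v w m|b v m1 m2|v w m].
- by rewrite mulrDr -scalerAr; apply: tensPl.
- exact: tensPr.
- have E := tens_bal (u * v) w m.
  by rewrite -E mulrA.
Qed.

Lemma ind_uactE u v (m : M) : ind_uact u (tens v m) = tens (u * v) m.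
Proof.
apply: tens_lift => /= [b v' w m'|b v' m1 m2|v' w m'].
- by rewrite mulrDr -scalerAr; apply: tensPl.
- exact: tensPr.
- have E := tens_bal (u * v') w m'.
  by rewrite -E mulrA.
Qed.

Lemma ind_uact0 u : ind_uact u (0 : ind M) = 0.
Proof.
by have := ind_uactPr (-1) u 0 0; rewrite scaler0 addr0 scaleN1r addNr.
Qed.

Lemma ind_uactPl a u v (t : ind M) :
  ind_uact (a *: u + v) t = a *: ind_uact u t + ind_uact v t.
Proof.
elim/tens_ind: t => [|b w m t IH]; first by rewrite !ind_uact0 scaler0 addr0.
have E : tens ((a *: u + v) * w) m = a *: tens (u * w) m + tens (v * w) m.
  by rewrite mulrDl -scalerAl; apply: tensPl.
rewrite !ind_uactPr IH !ind_uactE {}E.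
move: (tens _ m) (tens _ m) (ind_uact u t) (ind_uact v t) => t1 t2 t3 t4.
by rewrite !scalerDr !scalerA [b * a]mulrC addrACA.
Qed.

Lemma ind_uactM u v (t : ind M) : ind_uact (u * v) t = ind_uact u (ind_uact v t).
Proof.
elim/tens_ind: t => [|b w m t IH]; first by rewrite !ind_uact0.
by rewrite !ind_uactPr IH !ind_uactE mulrA.
Qed.

Fact ind_actPl a x y (t : ind M) :
  ind_act (a *: x + y) t = a *: ind_act x t + ind_act y t.
Proof. by rewrite /ind_act linearP ind_uactPl. Qed.
Fact ind_actPr a x (s t : ind M) :
  ind_act x (a *: s + t) = a *: ind_act x s + ind_act x t.
Proof. exact: ind_uactPr. Qed.
Fact ind_act_lieb x y (t : ind M) :
  ind_act (lieb x y) t = ind_act x (ind_act y t) - ind_act y (ind_act x t).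
Proof.
rewrite /ind_act Uin_lieb -scaleN1r addrC ind_uactPl !ind_uactM.
by rewrite scaleN1r addrC.
Qed.

HB.instance Definition _ := Lmodule_isLieModule.Build K g (ind M)
  ind_actPl ind_actPr ind_act_lieb.

End IndAction.

Definition ind_mod (M : lieModType (sublie n)) : lieModType g := ind M.

Lemma ind_lactE (M : lieModType (sublie n)) x u (m : M) :
  lact x (tens u m : ind_mod M) = tens (Uin x * u) m.
Proof. exact: ind_uactE. Qed.

Lemma uact_lieHom (M N : lieModType (sublie n)) (f : lieHom M N) w m :
  f (uact w m) = uact w (f m).
Proof.
rewrite /uact; elim/malg_ind: (repr w) => [|a k p IH]; first by rewrite !linear0.
rewrite !mext_is_linear linearP IH !mextU; congr (_ *: _ + _).
by rewrite /word_act; elim: (k : seq _) => //= x s <-; rewrite lieHomE.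
Qed.

Section IndMap.
Context {M N : lieModType (sublie n)} (f : lieHom M N).

Definition ind_fun (t : ind_mod M) : ind_mod N :=
  mext (fun um : (Uenv g * M)%type => tens um.1 (f um.2)) (repr t).

Fact ind_fun_is_linear : linear ind_fun.
Proof.
apply: tens_lift_linear => /= *; first by rewrite tensPl.
- by rewrite linearP tensPr.
- by rewrite uact_lieHom tens_bal.
Qed.
HB.instance Definition _ :=
  GRing.isLinear.Build K (ind_mod M) (ind_mod N) _ ind_fun ind_fun_is_linear.

Lemma ind_funE u m : ind_fun (tens u m) = tens u (f m).
Proof.
apply: tens_lift => /= *; first by rewrite tensPl.
- by rewrite linearP tensPr.
- by rewrite uact_lieHom tens_bal.
Qed.

Fact ind_fun_act x t : ind_fun (lact x t) = lact x (ind_fun t).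
Proof.
elim/tens_ind: t => [|a u m t IH]; first by rewrite !linear0.
rewrite lactPr ind_fun_is_linear {}IH [in RHS]ind_fun_is_linear lactPr; congr (_ *: _ + _).
by rewrite (ind_lactE (M := M)) !ind_funE (ind_lactE (M := N)).
Qed.

Definition ind_map : lieHom (ind_mod M) (ind_mod N) :=
  @LieHom K g (ind_mod M) (ind_mod N) ind_fun ind_fun_act.

End IndMap.

Fact ind_map_id (M : lieModType (sublie n)) :
  ind_map (lieHom_id M) = lieHom_id (ind_mod M).
Proof.
apply: lieHom_eq => t /=; elim/tens_ind: t => [|a u m t IH].
  by rewrite linear0.
by rewrite linearP /= IH ind_funE.
Qed.
Fact ind_map_comp (M N P : lieModType (sublie n)) (f : lieHom N P)
    (e : lieHom M N) :
  ind_map (lieHom_comp f e) = lieHom_comp (ind_map f) (ind_map e).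
Proof.
apply: lieHom_eq => t /=; elim/tens_ind: t => [|a u m t IH].
  by rewrite !linear0.
by rewrite !linearP /= IH !ind_funE.
Qed.

Definition Ind : functor (lieModCat (sublie n)) (lieModCat g) :=
  @Functor (lieModCat (sublie n)) (lieModCat g) ind_mod
    (fun M N => @ind_map M N) ind_map_id ind_map_comp.

End Induction.

Section WCategories.
Context {K : fieldType}.

Definition countable_dim (V : lmodType K) : Prop :=
  exists e : nat -> V, forall v, lspan (fun s => exists i, s = e i) v.

(* dim U(h) v < oo for every v in M. *)
Definition locally_finite (h : lieAlgType K) (M : lieModType h) : Prop :=
  forall v : M, finite_dim (fun w : M => exists u : Uenv h, w = uact u v).

(* W^h_h and W^g_n. All vector spaces are meant to have at most countable
   dimension, so this is part of membership. *)
Definition inW_self (h : lieAlgType K) (M : lieModCat h) : Prop :=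
  countable_dim M /\ locally_finite M.

Definition inW (g : lieAlgType K) (n : lieSubalg g) (M : lieModCat g) : Prop :=
  countable_dim M /\ locally_finite (Res n M).

Definition Wcat_self (h : lieAlgType K) : category :=
  full_subcat (@inW_self h).
Definition Wcat (g : lieAlgType K) (n : lieSubalg g) : category :=
  full_subcat (inW n).

End WCategories.

(* Main.v *)
(* A vector is finite when it lies in the span of a finite n-stable family.
   If g/n is locally finite, the n-finite vectors of a g-module form a
   g-submodule.  In Ind M this submodule contains 1 (x) M, since
   x . (1 (x) m) = 1 (x) x . m for x in n, and 1 (x) M generates Ind M.
   The Frobenius adjunction f |-> (m |-> f (1 (x) m)) then restricts to the
   full subcategories. *)
From HB Require Import structures.
Require Import Defs.
From mathcomp Require Import all_boot all_order all_algebra.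
From mathcomp Require Import reals complex.
From mathcomp Require Import boolp monalg.

Set Implicit Arguments.
Unset Strict Implicit.
Unset Printing Implicit Defensive.
Import GRing.Theory.
Local Open Scope ring_scope.

(** * Spans and finite-dimensional families *)

Section LinearSpan.
Context {K : fieldType}.

Lemma linear_fun0 (V W : lmodType K) (f : V -> W) : linear f -> f 0 = 0.
Proof. by move=> fL; have := fL (-1) 0 0; rewrite !scaleN1r !addNr. Qed.

Lemma lspan_map (V W : lmodType K) (f : V -> W) (S : V -> Prop)
    (T : W -> Prop) v : linear f ->
  (forall s, S s -> lspan T (f s)) -> lspan S v -> lspan T (f v).
Proof.
move=> fL fST; elim=> [|a s w Ss _ IH]; first by rewrite linear_fun0//; left.
by rewrite fL; apply: spanD IH; apply/spanZ/fST.
Qed.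

Lemma lspan_trans (V : lmodType K) (S T : V -> Prop) v :
  (forall s, S s -> lspan T s) -> lspan S v -> lspan T v.
Proof. exact: (@lspan_map _ _ id). Qed.

Lemma lspan_cons (V : lmodType K) (x : V) (e : seq V) v :
  lspan (fun s => s \in x :: e) v ->
  exists a, lspan (fun s => s \in e) (v - a *: x).
Proof.
elim=> [|a s w]; first by exists 0; rewrite scale0r subr0; left.
rewrite inE => /orP[/eqP->|se] _ [b wb].
  by exists (a + b); rewrite scalerDl opprD addrACA subrr add0r.
by exists b; rewrite -addrA; apply: Defs.span_cons.
Qed.

(** Once [s0] is itself a generator, each shifted vector [s + c *: s0] can be traded for [s], so
    generators of shifts become generators taken from [S]. *)
Lemma lspan_lift (V : lmodType K) (S : V -> Prop) (s0 : V) (e : seq V) :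
  (forall t, t \in e -> exists2 s, S s & exists c, t = s + c *: s0) ->
  exists2 e', (forall s, s \in e' -> S s) &
    forall t, t \in e -> lspan (fun s => s \in s0 :: e') t.
Proof.
elim: e => [|t e IH] eS; first by exists [::].
have [|e' e'S ee'] := IH; first by move=> u ue; apply: eS; rewrite inE ue orbT.
have [s Ss [c tE]] := eS t (mem_head _ _).
exists (s :: e') => [u|u]; rewrite inE => /orP[/eqP->//|]; first exact: e'S.
  rewrite tE; apply: spanD; last apply: spanZ; apply: span_base.
    by rewrite !inE eqxx orbT.
  exact: mem_head.
move=> /ee'; apply: lspan_trans => w; rewrite inE => /orP[/eqP->|we'].
  by apply: span_base; exact: mem_head.
by apply: span_base; rewrite !inE we' !orbT.
Qed.

(** [finite_dim] asks for generators inside [S], which may fail to be a subspace. Induction on [e]: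
    if some [s0] in [S] lies outside the span of the tail, subtracting multiples of [s0] from the
    elements of [S] eliminates the head [x]. *)
Lemma finite_dim_sub (V : lmodType K) (e : seq V) (S : V -> Prop) :
  (forall v, S v -> lspan (fun s => s \in e) v) -> finite_dim S.
Proof.
elim: e S => [|x e IH] S Se.
  by exists [::]; split=> [s|//]; rewrite in_nil.
have [[s0 Ss0 Ns0]|Sall] := pselect (exists2 s0, S s0 &
    ~ lspan (fun s => s \in e) s0); last first.
  by apply: IH => v Sv; apply: contrapT => Nv; apply: Sall; exists v.
have [a s0a] := lspan_cons (Se _ Ss0).
have a0 : a != 0.
  by apply/eqP => a0; move: s0a; rewrite a0 scale0r subr0.
pose S' t := lspan (fun s => s \in e) t /\
  exists2 s, S s & exists c, t = s + c *: s0.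
have [|d [dS' S'd]] := IH S'; first by move=> t [].
have [e' e'S de'] := lspan_lift (fun t td => (dS' t td).2).
exists (s0 :: e'); split=> [s|v Sv].
  by rewrite inE => /orP[/eqP->//|/e'S].
have [b vb] := lspan_cons (Se _ Sv).
(* [b] and [a] are coefficients of [x] in [v] and [s0], so the multiples of [x] cancel. *)
have S'v : S' (v + (- (b / a)) *: s0).
  split; last by exists v => //; exists (- (b / a)).
  have -> : v + (- (b / a)) *: s0 = v - b *: x + (- (b / a)) *: (s0 - a *: x).
    rewrite scalerBr scalerA mulNr divfK // scaleNr scaleNr opprK.
    by rewrite [- _ + _]addrC addrA subrK.
  by apply: spanD vb _; apply: spanZ.
rewrite -[v](addrK ((- (b / a)) *: s0)); apply: spanD.
  exact: lspan_trans de' (S'd _ S'v).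
by rewrite -scaleNr; apply/spanZ/span_base/mem_head.
Qed.

End LinearSpan.

(** * Finite vectors of a Lie module *)

Section FiniteVectors.
Context {K : fieldType} {h : lieAlgType K} {M : lieModType h}.

Definition finite_vec (v : M) : Prop := exists2 e : seq M,
  lspan (fun s => s \in e) v &
  forall x s, s \in e -> lspan (fun t => t \in e) (lact x s).

Lemma lact_linear (x : h) : linear (lact x : M -> M).
Proof. by move=> a m1 m2; exact: lactPr. Qed.

Lemma lact_linearl (m : M) : linear (fun x : h => lact x m).
Proof. by move=> a x y; exact: lactPl. Qed.

Lemma uact_stable (S : M -> Prop) u v :
  (forall x s, S s -> lspan S (lact x s)) -> lspan S v -> lspan S (uact u v).
Proof.
move=> Sx Sv; rewrite -[u]UpiK uact_pi.
elim/malg_ind: (repr u) => [|a k p IH].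
  by rewrite (linear_fun0 (mext_is_linear _)); left.
rewrite mext_is_linear mextU; apply: spanD IH; apply: spanZ.
rewrite /word_act; elim: (k : seq h) => //= x s.
by apply: (lspan_map (lact_linear x)) => t; exact: Sx.
Qed.

(** A stable family spanning [v] also spans the whole orbit of [v] under U(h). Conversely,
    generators chosen inside the orbit form a stable family, since the orbit is closed under [h]. *)
Lemma finite_vecP v :
  finite_vec v <-> finite_dim (fun w : M => exists u : Uenv h, w = uact u v).
Proof.
split=> [[e ve eh]|[e [eo oe]]].
  by apply: (@finite_dim_sub _ _ e) => _ [u ->]; apply: uact_stable.
exists e => [|x s /eo[u ->]]; first by apply: oe; exists 1; rewrite uact1.
by apply: oe; exists (Uin x * u); rewrite uactM uact_Uin.
Qed.

Lemma finite_vec0 : finite_vec 0.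
Proof. by exists [::] => //; left. Qed.

Lemma finite_vec_lin a v w :
  finite_vec v -> finite_vec w -> finite_vec (a *: v + w).
Proof.
move=> [e ve eh] [f wf fh].
have sub1 t : lspan (fun s => s \in e) t -> lspan (fun s => s \in e ++ f) t.
  by apply: lspan_trans => s se; apply: span_base; rewrite mem_cat se.
have sub2 t : lspan (fun s => s \in f) t -> lspan (fun s => s \in e ++ f) t.
  by apply: lspan_trans => s se; apply: span_base; rewrite mem_cat se orbT.
exists (e ++ f) => [|x s]; first by apply: spanD; [apply/spanZ/sub1|apply/sub2].
by rewrite mem_cat => /orP[/eh/sub1|/fh/sub2].
Qed.

End FiniteVectors.

(** * Induction and spanning sets in U(h) *)

Section Enveloping.
Context {K : fieldType} {h : lieAlgType K}.

Lemma Upi_word (k : {fmonom h}) : Upi << k >> = \prod_(x <- (k : seq h)) Uin x.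
Proof.
case: k => s; elim: s => [|x s IH].
  by have -> : FMonom [::] = fmone h; [rewrite fmoneE|
    rewrite fmoneE big_nil -fmoneE].
rewrite big_cons -IH /Uin -UpiM fgenE malgM_def fgmulUU mulr1; congr (Upi << _ >>).
by apply: val_inj; rewrite /= fmM fmuE.
Qed.

Lemma Uenv_ind (P : Uenv h -> Prop) : P 1 ->
  (forall x u, P u -> P (Uin x * u)) ->
  (forall a u v, P u -> P v -> P (a *: u + v)) -> forall u, P u.
Proof.
move=> P1 Px PL u; rewrite -[u]UpiK; elim/malg_ind: (repr u) => [|a k p IH].
  (* The zero case is the combination [-1 *: 1 + 1]. *)
  by have := PL (-1) _ _ P1 P1; rewrite scaleN1r addNr linear0.
rewrite UpiD UpiZ; apply: PL IH; rewrite Upi_word.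
elim: (k : seq h) => [|x s IH]; first by rewrite big_nil.
by rewrite big_cons; apply: Px.
Qed.

(** For countable [I] the words are countable in number, which bounds the dimension of U(h). *)
Lemma Uenv_span_words (I : Type) (e : I -> h) (u : Uenv h) :
  (forall x, lspan (fun y => exists i, y = e i) x) ->
  lspan (fun w => exists s : seq I, w = \prod_(i <- s) Uin (e i)) u.
Proof.
move=> eh; elim/Uenv_ind: u => [|x u|a u v Pu Pv].
- by apply: span_base; exists [::]; rewrite big_nil.
- apply: lspan_map => [a v w|_ [s ->]]; first by rewrite mulrDr scalerAr.
  apply: (@lspan_map _ _ _ (fun x => Uin x * _)) (eh x) => [a v w|_ [i ->]].
    by rewrite linearP mulrDl scalerAl.
  by apply: span_base; exists (i :: s); rewrite big_cons.
- by apply: spanD Pv; apply: spanZ.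
Qed.

End Enveloping.

Lemma countable_dimP (K : fieldType) (V : lmodType K) (I : countType)
    (e : I -> V) :
  (forall v, lspan (fun s => exists i, s = e i) v) -> countable_dim V.
Proof.
(* Numbers that encode no index are sent to 0, which leaves the span unchanged. *)
move=> eV; exists (fun k : nat => oapp e 0 (choice.unpickle k)) => v.
apply: lspan_trans (eV v) => _ [i ->]; apply: span_base.
by exists (choice.pickle i); rewrite choice.pickleK.
Qed.

(** * Countable dimension and local finiteness of the induced module *)

Section Induced.
Context {K : fieldType} {g : lieAlgType K} (n : lieSubalg g).

Lemma Uin_val_linear : linear (fun x : sublie n => Uin (val x)).
Proof. by move=> a x y; rewrite linearP. Qed.

Lemma Uin_val_lieb (x y : sublie n) :
  Uin (val (lieb x y)) = Uin (val x) * Uin (val y) - Uin (val y) * Uin (val x).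
Proof. exact: Uin_lieb. Qed.

Lemma Usub_Uin (x : sublie n) : Usub (Uin x) = Uin (val x).
Proof. exact: (Ulift_Uin Uin_val_linear Uin_val_lieb). Qed.

(** Both sides are multiplicative and linear in [w] and agree on [n]. This makes the extension of an
    n-map to Ind M balanced over U(n). *)
Lemma uact_Usub (N : lieModType g) (w : Uenv (sublie n)) (m : N) :
  uact (Usub w) m = uact w (m : res_mod n N).
Proof.
elim/(@Uenv_ind _ (sublie n)): w => [|x u IH|a u v IHu IHv].
- by rewrite /Usub (Ulift1 Uin_val_linear Uin_val_lieb) !uact1.
- rewrite /Usub (UliftM Uin_val_linear Uin_val_lieb) -!/(Usub _) Usub_Uin !uactM IH.
  by rewrite !uact_Uin.
- by rewrite /Usub (UliftP Uin_val_linear Uin_val_lieb) -!/(Usub _) !uactPl IHu IHv.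
Qed.

(** An element of [n] passes through the tensor sign, so [tens 1] is an n-map. *)
Lemma lact_tens1 (M : lieModType (sublie n)) (x : sublie n) (m : M) :
  lact (val x) (tens 1 m : ind_mod M) = tens 1 (lact x m).
Proof. by rewrite ind_lactE mulr1 -Usub_Uin -[Usub _]mul1r tens_bal uact_Uin. Qed.

Lemma finite_vec_res (N : lieModType g) (v : N) :
  finite_vec (v : res_mod n N) <->
  exists2 e : seq N, lspan (fun s => s \in e) v &
    forall x s, x \in n -> s \in e -> lspan (fun t => t \in e) (lact x s).
Proof.
split=> -[e ve en]; exists e => // x s.
  by move=> xn; exact: (en (Sub x xn)).
exact: en (valP x).
Qed.

(** [repr] is not linear; lifting a combination from g/n to [g] leaves an error in [n], hence the
    second alternative. *)
Lemma lspan_repr (f : seq (adquot n)) (x : g) :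
  lspan (fun q => q \in f) (modpi _ x : adquot n) ->
  lspan (fun y => y \in map repr f \/ y \in n) x.
Proof.
move=> fx; move qE: (modpi _ x : adquot n) fx => q fq.
elim: fq x qE => [|a s w sf _ IH] x qE.
  have /modpiP : modpi (fun x => x \in n) x = modpi _ 0 by rewrite linear0.
  by rewrite subr0; apply: lspan_trans => y yn; apply: span_base; right.
rewrite -[x](subrKC (a *: repr s)); apply: spanD.
  by apply/spanZ/span_base; left; apply: map_f.
by apply: IH; rewrite linearB linearZ /= modpiK qE addrAC subrr add0r.
Qed.

(* If e spans a finite-dimensional n-stable subspace containing v, and f lifts
   a spanning set of an n-stable finite-dimensional subspace of g/n containing
   the class of x, then e together with f . e is n-stable because
   z . (y . s) = [z, y] . s + y . (z . s). *)
Lemma finite_vec_lact (N : lieModType g) (x : g) (v : N) :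
  locally_finite (adquot n : lieModType (sublie n)) ->
  finite_vec (v : res_mod n N) -> finite_vec (lact x v : res_mod n N).
Proof.
move=> gn_fin /finite_vec_res[e ve en]; apply/finite_vec_res.
have /finite_vecP[f xf fn] := gn_fin (modpi _ x).
pose f' := map repr f; pose e' := e ++ [seq lact y s | y <- f', s <- e].
have ee' s : lspan (fun t => t \in e) s -> lspan (fun t => t \in e') s.
  by apply: lspan_trans => t te; apply: span_base; rewrite mem_cat te.
(* Factors from [f'] land in the second block of [e']; factors from [n] keep [s] in the span of
   [e]. *)
have fee' y s : lspan (fun y => y \in f' \/ y \in n) y ->
    lspan (fun t => t \in e) s -> lspan (fun t => t \in e') (lact y s).
  move=> fy es; apply: (lspan_map (lact_linearl s)) fy => {}y fy.
  apply: (lspan_map (lact_linear y)) es => {}s es.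
  case: fy => [fy|yn]; last exact/ee'/en.
  by apply: span_base; rewrite mem_cat (allpairs_f _ fy es) orbT.
exists e' => [|z t zn]; first by apply: fee' ve; apply: lspan_repr.
rewrite mem_cat => /orP[te|/allpairsP[[y s] /= [yf se ->]]]; first exact/ee'/en.
rewrite -[lact z _](subrK (lact y (lact z s))) -lact_lieb; apply: spanD.
  apply: fee'; last exact: span_base.
  have /mapP[q qf ->] := yf; apply: lspan_repr.
  have := fn (Sub z zn) q qf.
  by rewrite -[q in lact _ q]modpiK /= [lact _ _]adquot_actE.
by apply: fee' (en _ _ zn se); apply: span_base; left.
Qed.

Lemma ind_inW (M : lieModCat (sublie n)) : countable_dim g ->
  inW_self (adquot n : lieModType (sublie n)) -> inW_self M -> inW n (Ind n M).
Proof.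
(* Words in the spanning family of [g], tensored with the spanning family of [M], span Ind M. *)
move=> [eg egP] [_ gn_fin] [[eM eMP] M_fin]; split.
  apply: (@countable_dimP _ _ (seq nat * nat)%type
    (fun si => tens (\prod_(i <- si.1) Uin (eg i)) (eM si.2))) => t.
  elim/(@tens_ind _ _ n M): t => [|a u m t IH]; first by left.
  apply: spanD IH; apply: spanZ.
  apply: (@lspan_map _ _ _ (fun m => tens u m)) (eMP m) => [b m1 m2|_ [i ->]].
    exact: tensPr.
  apply: (@lspan_map _ _ _ (fun u => tens u _)) (Uenv_span_words u egP).
    by move=> b u1 u2; exact: tensPl.
  by move=> _ [s ->]; apply: span_base; exists (s, i).
move=> t; apply/finite_vecP; elim/(@tens_ind _ _ n M): t => [|a u m t IH].
  exact: finite_vec0.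
(* Induction on the left factor: for 1, the image under [tens 1] of a stable family around [m] is
   stable; each further factor from [g] is absorbed by [finite_vec_lact]. *)
apply: finite_vec_lin IH; elim/(@Uenv_ind _ g): u => [|x u IH|b u v IHu IHv].
- have /finite_vecP[e me en] := M_fin m.
  have tL : linear (tens 1 : M -> ind M) by move=> *; exact: tensPr.
  apply/finite_vec_res; exists (map (tens 1) e).
    by apply: (lspan_map tL) me => s se; apply/span_base/map_f.
  move=> x _ xn /mapP[s se ->]; rewrite -[x]/(val (Sub x xn : sublie n)).
  rewrite lact_tens1; apply: (lspan_map tL) (en _ _ se) => r re.
  exact/span_base/map_f.
- by rewrite -ind_lactE; apply: finite_vec_lact.
- by rewrite tensPl; apply: finite_vec_lin.
Qed.

End Induced.

(** * Frobenius reciprocity *)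

Section FrobeniusReciprocity.
Context {K : fieldType} {g : lieAlgType K} (n : lieSubalg g).
Context {M : lieModType (sublie n)} {N : lieModType g}.

Section ToRes.
Context (f : lieHom (ind_mod M) N).

(** The composite of [f] with the unit of the adjunction. *)
Definition ind_unit (m : M) : res_mod n N := f (tens 1 m).

Fact ind_unit_linear : linear ind_unit.
Proof. by move=> a m1 m2; rewrite /ind_unit tensPr linearP. Qed.
HB.instance Definition _ :=
  GRing.isLinear.Build K M (res_mod n N) _ ind_unit ind_unit_linear.

Fact ind_unit_act x m : ind_unit (lact x m) = lact x (ind_unit m).
Proof. by rewrite /ind_unit -lact_tens1 lieHomE. Qed.

Definition ind_to_res : lieHom M (res_mod n N) :=
  @LieHom K (sublie n) M (res_mod n N) ind_unit ind_unit_act.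

End ToRes.

Section ToInd.
Context (f : lieHom M (res_mod n N)).

Definition ind_extend (t : ind_mod M) : N :=
  mext (fun um : (Uenv g * M)%type => uact um.1 (f um.2 : N)) (repr t).

(** These three facts discharge the side conditions of [tens_lift_linear] and [tens_lift]: the
    extension respects the tensor relations. *)
Let extPl a u v (m : M) :
  uact (a *: u + v) (f m : N) = a *: uact u (f m : N) + uact v (f m : N).
Proof. exact: uactPl. Qed.
Let extPr a (u : Uenv g) (m1 m2 : M) :
  uact u (f (a *: m1 + m2) : N) = a *: uact u (f m1 : N) + uact u (f m2 : N).
Proof. by rewrite linearP; exact: uactPr. Qed.
Let ext_bal u (w : Uenv (sublie n)) (m : M) :
  uact (u * Usub w) (f m : N) = uact u (f (uact w m) : N).
Proof. by rewrite uactM uact_Usub uact_lieHom. Qed.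

Fact ind_extend_linear : linear ind_extend.
Proof. exact: tens_lift_linear. Qed.
HB.instance Definition _ :=
  GRing.isLinear.Build K (ind_mod M) N _ ind_extend ind_extend_linear.

Lemma ind_extendE u m : ind_extend (tens u m) = uact u (f m : N).
Proof. exact: (tens_lift (f := fun um => uact um.1 (f um.2 : N))). Qed.

Fact ind_extend_act x t : ind_extend (lact x t) = lact x (ind_extend t).
Proof.
elim/(@tens_ind _ _ n M): t => [|a u m t IH]; first by rewrite !linear0.
rewrite lactPr !ind_extend_linear lactPr IH; congr (_ *: _ + _).
by rewrite ind_lactE !ind_extendE uactM uact_Uin.
Qed.

Definition res_to_ind : lieHom (ind_mod M) N :=
  @LieHom K g (ind_mod M) N ind_extend ind_extend_act.

End ToInd.

(** A g-map out of Ind M is determined by its values on the vectors [tens 1 m], because they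
    generate Ind M over U(g). *)
Lemma ind_to_resK : cancel ind_to_res res_to_ind.
Proof.
move=> f; apply: lieHom_eq => t /=.
elim/(@tens_ind _ _ n M): t => [|a u m t IH]; first by rewrite !linear0.
rewrite ind_extend_linear IH linearP; congr (_ *: _ + _).
rewrite ind_extendE /= /ind_unit.
elim/(@Uenv_ind _ g): u => [|x u IHu|b u v IHu IHv].
- by rewrite uact1.
- by rewrite uactM IHu uact_Uin -lieHomE ind_lactE.
- by rewrite uactPl IHu IHv tensPl linearP.
Qed.

Lemma res_to_indK : cancel res_to_ind ind_to_res.
Proof.
move=> f; apply: lieHom_eq => m /=.
by rewrite /ind_unit /= ind_extendE uact1.
Qed.

End FrobeniusReciprocity.

Theorem theorem6 (R : realType) (g : lieAlgType R[i]) (n : lieSubalg g)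
    (g_countable : countable_dim g)
    (gn_W : inW_self (adquot n : lieModType (sublie n))) :
  exists (Ind_W : forall M : lieModCat (sublie n), inW_self M -> inW n (Ind n M))
         (Res_W : forall N : lieModCat g, inW n N -> inW_self (Res n N)),
    adjoint_pair (full_functor Ind_W : functor (Wcat_self (sublie n)) (Wcat n))
                 (full_functor Res_W : functor (Wcat n) (Wcat_self (sublie n))).
Proof.
(* Restriction keeps the underlying space, so both membership conditions unfold to the same one. *)
exists (fun M => ind_inW g_countable gn_W), (fun N N_W => N_W).
exists (fun X Y => @ind_to_res _ g n (sval X) (sval Y)); split=> [X Y|].
  by exists (@res_to_ind _ g n (sval X) (sval Y));
    [exact: ind_to_resK|exact: res_to_indK].
(* Naturality: both sides send [m] to [b (f (tens 1 (a m)))]. *)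
move=> X X' Y Y' a b f; apply: lieHom_eq => m.
by rewrite /= /ind_unit /= ind_funE.
Qed.
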